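(* Let $\{A,B,C\}\subseteq\mathbb{S}^n$ and suppose $A$ is invertible. Then $\{A,B,C\}$ is ASDC if and only if $A^{-1}B$ and $A^{-1}C$ are a pair of commuting matrices with real eigenvalues (i.e., they commute and all eigenvalues of each are real).
   Context: $\mathbb{S}^n$ denotes the real vector space of $n\times n$ real symmetric matrices. A set $\mathcal{A}\subseteq\mathbb{S}^n$ is simultaneously diagonalizable via congruence (SDC) if there exists an invertible $P\in\mathbb{R}^{n\times n}$ such that $P^\top A P$ is diagonal for all $A\in\mathcal{A}$. A set $\mathcal{A}\subseteq\mathbb{S}^n$ is almost simultaneously diagonalizable via congruence (ASDC) if there exist sequences $A_i\to A$ in $\mathbb{S}^n$, one for every $A\in\mathcal{A}$, such that for every $i\in\mathbb{N}$ the set $\{A_i : A\in\mathcal{A}\}$ is SDC. *)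

(* Defs.v *)
From HB Require Import structures.
From mathcomp Require Import all_boot all_order all_algebra.
From mathcomp Require Import sesquilinear.
From mathcomp Require Import complex.
From mathcomp Require Import all_classical all_reals all_analysis.

Set Implicit Arguments.
Unset Strict Implicit.
Unset Printing Implicit Defensive.

Import Order.TTheory GRing.Theory Num.Theory.
Import numFieldNormedType.Exports.

Local Open Scope classical_set_scope.
Local Open Scope ring_scope.

Definition SDC (R : realType) (n : nat) (F : set 'M[R]_n) : Prop :=
  exists2 P : 'M[R]_n, P \in unitmx &
    forall M, F M -> is_diag_mx (P^T *m M *m P).

(* [u M] is the sequence attached to [M]; its values for [M] outside [F] are
   irrelevant.  Convergence is for the (entrywise) topology on ['M[R]_n]. *)
Definition ASDC (R : realType) (n : nat) (F : set 'M[R]_n) : Prop :=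
  exists u : 'M[R]_n -> nat -> 'M[R]_n,
    (forall M, F M ->
       (forall i, u M i \is symmetricmx) /\ (u M i @[i --> \oo] --> M)) /\
    (forall i, SDC [set u M i | M in F]).

(* Eigenvalues are taken over the complex numbers [R[i]]: over [R] itself the
   condition would be vacuous. *)
Definition real_eigenvalues (R : realType) (n : nat) (M : 'M[R]_n) : Prop :=
  forall z : R[i],
    eigenvalue (map_mx (real_complex R) M) z -> complex.Im z = 0.

(* Main.v *)
Require Import Defs.
From HB Require Import structures.
From mathcomp Require Import all_boot all_order all_algebra.
From mathcomp Require Import sesquilinear.
From mathcomp Require Import complex.
From mathcomp Require Import all_classical all_reals all_analysis.
From mathcomp Require Import zify ring lra.

(** Put [G = A^-1], [X = A^-1 B] and [Y = A^-1 C], acting on row vectors from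
    the right.  Then [G] is the Gram matrix of a nondegenerate symmetric form
    for which [X] and [Y] are self-adjoint: [X G] and [Y G] are symmetric.  With
    [P = G Q^T], the matrices [P^T A P], [P^T (A X) P] and [P^T (A Y) P] are
    [Q G Q^T], [Q X G Q^T] and [Q Y G Q^T].  The theorem thus describes the
    closure of the set of pairs that are diagonal in a common [G]-orthogonal
    basis.

    Necessity.  If [A_i], [B_i], [C_i] are simultaneously diagonal under
    congruence and [A_i] is invertible, then [A_i^-1 B_i] and [A_i^-1 C_i] are
    diagonal in the same real basis.  They commute, and
    [det ((X_i - a)^2 + b^2) >= b^(2n)] for all real [a], [b], because each
    diagonal entry of a diagonal [(D - a)^2 + b^2] is at least [b^2].  Both facts
    pass to the limit, and the inequality forbids an eigenvalue [a + ib] with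
    [b != 0].

    Sufficiency.  By induction on the dimension, every commuting self-adjoint
    pair [(X, Y)] with real spectra lies in the closure ([approximable_all]),
    with [G] kept fixed.  If [X] or [Y] has two distinct eigenvalues, the space
    is an orthogonal sum of two smaller invariant subspaces
    ([decomposable_blocks], [diag_pairs_blocks]).  It is therefore enough to move
    the pair by an arbitrarily small amount to a commuting self-adjoint pair with
    real spectra in which one member has two distinct eigenvalues.  After a
    shift, [X] and [Y] are nilpotent.  Let [k + 1] be the largest nilpotency
    index in the pencil [Y + t X]; replacing [Y] by a member of the pencil that
    attains it, [Y^k != 0] and, by maximality, [Y^k X = 0]
    ([pencil_top_power]).  The form [Y^k G] is symmetric and nonzero, so some
    [v] satisfies [v Y^k G v^T != 0].

    - If [k + 1] is less than the dimension, differentiate the power map: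
      [Z], the derivative of [Y^(k+1)] in the direction of the rank-one matrix
      [G v^T v], commutes with [Y] and is self-adjoint.  On the kernel of [Y] it
      is a rank-one map onto the line of [w = v Y^k], which [X] kills.  Hence
      [X + e Z] has exactly the real eigenvalues [0] and [e (v Y^k G v^T)]
      ([root_split_cyclic_dir], [decomposable_cyclic_dir]).

    - Otherwise [v] is a cyclic vector of [Y], and [X = p(Y)] for a polynomial
      [p] ([cyclic_commutant]).  Then [Y] alone is moved, to [N = Y + e G u^T u]
      with [u = v Y^(k/2)], and [X] to [p(N)].  The eigenvalues of [N] are among
      [0] and the roots of a quadratic polynomial, whose discriminant is positive
      for a suitable sign of [e] ([splitting_dir_splits]). *)

Set Implicit Arguments.
Unset Strict Implicit.
Unset Printing Implicit Defensive.

Import Order.TTheory GRing.Theory Num.Theory.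
Import numFieldNormedType.Exports.

Local Open Scope classical_set_scope.
Local Open Scope ring_scope.

(** * Self-adjoint matrices and orthogonal decompositions *)

Definition selfadj (F : fieldType) n (G X : 'M[F]_n) := (X *m G)^T = X *m G.

(** Over a real closed field this says that the spectrum is real.  Stated this way
    it clearly survives restriction to an invariant subspace and polynomial maps,
    and it can be proved without a characteristic polynomial. *)
Definition root_split (F : fieldType) n (M : 'M[F]_n.+1) :=
  exists s : seq F, horner_mx M (\prod_(a <- s) ('X - a%:P)) = 0.

(** The spectrum of [M] falls into two nonempty disjoint parts, the roots of [p]
    and those of [q]. *)
Definition decomposable (F : fieldType) n (M : 'M[F]_n.+1) :=
  exists p q : {poly F}, [/\ coprimep p q, horner_mx M (p * q) = 0,
    horner_mx M p != 0 & horner_mx M q != 0].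

Lemma selfadjE (F : fieldType) n (G X : 'M[F]_n) :
  G^T = G -> selfadj G X -> G *m X^T = X *m G.
Proof. by move=> sG <-; rewrite trmx_mul sG. Qed.

Lemma selfadjP (F : fieldType) n (G X : 'M[F]_n) :
  G^T = G -> G *m X^T = X *m G -> selfadj G X.
Proof. by move=> sG e; rewrite /selfadj trmx_mul sG. Qed.

Lemma selfadjM (F : fieldType) n (G X Y : 'M[F]_n) :
  G^T = G -> selfadj G X -> selfadj G Y -> X *m Y = Y *m X ->
  selfadj G (X *m Y).
Proof.
move=> sG sX sY cXY; apply: selfadjP => //.
by rewrite {1}cXY trmx_mul mulmxA (selfadjE sG sX) -mulmxA
  (selfadjE sG sY) mulmxA.
Qed.

Lemma selfadjD (F : fieldType) n (G X Y : 'M[F]_n) :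
  selfadj G X -> selfadj G Y -> selfadj G (X + Y).
Proof. by move=> sX sY; rewrite /selfadj mulmxDl linearD/= sX sY. Qed.

Lemma selfadjZ (F : fieldType) n (G X : 'M[F]_n) a :
  selfadj G X -> selfadj G (a *: X).
Proof. by move=> sX; rewrite /selfadj -scalemxAl linearZ/= sX. Qed.

Lemma selfadj_scalar (F : fieldType) n (G : 'M[F]_n) a :
  G^T = G -> selfadj G a%:M.
Proof. by move=> sG; rewrite /selfadj mul_scalar_mx linearZ/= sG. Qed.

Lemma selfadj_horner (F : fieldType) n (G X : 'M[F]_n.+1) p :
  G^T = G -> selfadj G X -> selfadj G (horner_mx X p).
Proof.
move=> sG sX; elim/poly_ind: p => [|p c IHp].
  by rewrite rmorph0 /selfadj mul0mx trmx0.
rewrite rmorphD rmorphM /= horner_mx_X horner_mx_C.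
apply: selfadjD; last exact: selfadj_scalar.
by apply: selfadjM => //; exact: comm_horner_mx.
Qed.

Lemma selfadjX (F : fieldType) n (G X : 'M[F]_n.+1) k :
  G^T = G -> selfadj G X -> selfadj G (X ^+ k).
Proof.
move=> sG sX; have := selfadj_horner 'X^k sG sX.
by rewrite rmorphXn/= horner_mx_X.
Qed.

Lemma coprimep_horner_unit (F : fieldType) n (M : 'M[F]_n.+1) p q :
  coprimep p q -> horner_mx M p = 0 -> horner_mx M q \in unitmx.
Proof.
move=> /Bezout_eq1_coprimepP[[u v]/= uv] p0.
have /mulmx1_unit[_ //] : horner_mx M v *m horner_mx M q = 1%:M.
have := congr1 (horner_mx M) uv.
by rewrite rmorphD !rmorphM/= p0 mulr0 add0r rmorph1.
Qed.

(** The kernels of [p(X)] and [q(X)] span the space by coprimality, and are stable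
    under everything that commutes with [X].  They are orthogonal: if
    [a p + b q = 1] then [w = w (a p)(X)] on the kernel of [q(X)], and
    self-adjointness moves [p(X)] to the other argument of the form, which it
    kills. *)
Lemma decomposable_blocks (F : fieldType) n (G X Y : 'M[F]_n.+1) :
    G^T = G -> selfadj G X -> X *m Y = Y *m X -> decomposable X ->
  exists n1 n2 (K1 : 'M[F]_(n1.+1, n.+1)) (K2 : 'M[F]_(n2.+1, n.+1)),
    [/\ (n = n1 + n2.+1)%N, row_free (col_mx K1 K2),
        stablemx K1 X /\ stablemx K2 X, stablemx K1 Y /\ stablemx K2 Y
      & K1 *m G *m K2^T = 0].
Proof.
move=> sG sX cXY [p [q [cpq pq0 p0 q0]]].
have stY r : stablemx (kermxpoly X r) Y by exact: comm_mx_stable_kermxpoly.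
have stX r : stablemx (kermxpoly X r) X by exact: comm_mx_stable_kermxpoly.
have ker_gt0 r s : horner_mx X (r * s) = 0 -> horner_mx X r != 0 ->
    (0 < \rank (kermxpoly X s))%N.
  rewrite lt0n mxrank_eq0 rmorphM/= => rs0; apply: contraNneq => k0.
  by rewrite -submx0 -[X in (_ <= X)%MS]k0; apply/sub_kermxP.
have r1 : (0 < \rank (kermxpoly X p))%N.
  by apply: (@ker_gt0 q) => //; rewrite mulrC.
have r2 : (0 < \rank (kermxpoly X q))%N by exact: (@ker_gt0 p).
have dir := mxdirect_kermxpoly X cpq.
have sum1 : (kermxpoly X p + kermxpoly X q :=: 1%:M)%MS.
  apply: eqmx_trans (eqmx_sym (kermxpolyM X cpq)) _.
  by rewrite /kermxpoly pq0; exact: kermx0.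
have rk : (\rank (kermxpoly X p) + \rank (kermxpoly X q) = n.+1)%N.
  by have /eqP := mxrank_sum_cap (kermxpoly X p) (kermxpoly X q);
     rewrite dir mxrank0 addn0 sum1 mxrank1 => /eqP.
have ort (u : 'M[F]_(\rank (kermxpoly X p), n.+1)) w :
    (u <= kermxpoly X p)%MS -> (w <= kermxpoly X q)%MS ->
    u *m G *m (w : 'M[F]_(\rank (kermxpoly X q), n.+1))^T = 0.
  move=> /sub_kermxP up /sub_kermxP wq.
  have /Bezout_eq1_coprimepP[[a b]/= ab] := cpq.
  have wbq : w *m horner_mx X (b * q) = 0.
    by rewrite mulrC rmorphM -mulmxE mulmxA wq mul0mx.
  have -> : w = w *m horner_mx X (a * p).
    have := congr1 (fun r => w *m horner_mx X r) ab.
    by rewrite rmorphD mulmxDr wbq addr0 rmorph1 mulmx1.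
  rewrite [a * p]mulrC trmx_mul -!mulmxA [G *m _]mulmxA
    (selfadjE sG (selfadj_horner _ sG sX)).
  by rewrite rmorphM -mulmxE !mulmxA up !mul0mx.
have l1 : (row_base (kermxpoly X p) <= kermxpoly X p)%MS by rewrite eq_row_base.
have l2 : (row_base (kermxpoly X q) <= kermxpoly X q)%MS by rewrite eq_row_base.
have free :
    row_free (col_mx (row_base (kermxpoly X p)) (row_base (kermxpoly X q))).
  by rewrite /row_free -addsmxE
    (adds_eqmx (eq_row_base _) (eq_row_base _)) sum1 mxrank1 rk.
have o := ort _ _ l1 l2.
have stB r Z : stablemx (kermxpoly X r) Z ->
    stablemx (row_base (kermxpoly X r)) Z.
  by rewrite stablemx_row_base.
have [sX1 sX2] := (stB _ _ (stX p), stB _ _ (stX q)).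
have [sY1 sY2] := (stB _ _ (stY p), stB _ _ (stY q)).
move: (row_base (kermxpoly X p))
  (row_base (kermxpoly X q)) free o sX1 sX2 sY1 sY2 =>
    {l1 l2 ort stB} K1 K2 free o sX1 sX2 sY1 sY2.
(* Both dimensions are positive, hence successors, as square-matrix rings need. *)
move: (\rank (kermxpoly X p))
  (\rank (kermxpoly X q)) r1 r2 rk K1 K2 free o sX1 sX2 sY1 sY2 =>
    [//|n1] [//|n2] _ _ rk K1 K2 free o sX1 sX2 sY1 sY2.
by exists n1, n2, K1, K2; split => //; case: rk.
Qed.

(** Either two different roots of the annihilating product really occur in the
    spectrum, or only one does. *)
Lemma root_split_cases (F : fieldType) n (M : 'M[F]_n.+1) :
  root_split M ->
  decomposable M \/ exists a k, (M - a%:M) ^+ k = 0.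
Proof.
case=> s; have [k] := ubnP (size s); elim: k s => // k IHk s.
case: s => [|a s] /= lsk s0.
  by move: s0; rewrite big_nil rmorph1 => /eqP; rewrite oner_eq0.
set P := \prod_(b <- a :: s) ('X - b%:P) in s0.
have evXa m : horner_mx M (('X - a%:P) ^+ m) = (M - a%:M) ^+ m.
  by rewrite rmorphXn rmorphB /= horner_mx_X horner_mx_C.
pose p := ('X - a%:P) ^+ (count_mem a (a :: s)).
pose t := [seq b <- s | b != a].
pose q := \prod_(b <- t) ('X - b%:P).
have Ppq : P = p * q.
  rewrite /P (bigID (pred1 a))/= -[X in _ * X]big_filter /=.
  rewrite /q /t eqxx /=; congr (_ * _).
  by rewrite /p (eq_bigr (fun=> 'X - a%:P)) => [|b /eqP->//];
    rewrite big_const_seq iter_mulr_1.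
have cpq : coprimep p q.
  rewrite /p coprimep_expl// /q big_seq.
  apply/(big_ind (fun r => coprimep ('X - a%:P) r)).
  - exact: coprimep1.
  - by move=> x y cx cy; rewrite coprimepMr cx.
  - by move=> b; rewrite mem_filter coprimep_XsubC root_XsubC => /andP[].
have [p0|pN0] := eqVneq (horner_mx M p) 0.
  by right; exists a, (count_mem a (a :: s)); rewrite -evXa.
have [q0|qN0] := eqVneq (horner_mx M q) 0; last first.
  by left; exists p, q; split; rewrite -?Ppq.
apply: (IHk t) => //; rewrite ltnS in lsk; apply: leq_ltn_trans lsk.
by rewrite size_filter count_size.
Qed.

(** * Matrices annihilated by products of linear factors *)

Lemma root_split_exp (F : fieldType) n (M : 'M[F]_n.+1) (s : seq F) k :
  horner_mx M ((\prod_(a <- s) ('X - a%:P)) ^+ k) = 0 -> root_split M.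
Proof.
move=> s0; exists (flatten (nseq k s)).
rewrite big_flatten/= big_nseq -[RHS]s0; congr (horner_mx M _).
by rewrite iter_mulr_1.
Qed.

Lemma root_split_nilpotent (F : fieldType) n (M : 'M[F]_n.+1) k :
  M ^+ k = 0 -> root_split M.
Proof.
move=> M0; apply: (@root_split_exp _ _ _ [:: 0] k).
by rewrite big_seq1 subr0 rmorphXn/= horner_mx_X.
Qed.

(** [p - p(a)] is divisible by ['X - a]: the eigenvalues of [p(M)] are the values
    of [p] at those of [M]. *)
Lemma root_split_horner (F : fieldType) n (M : 'M[F]_n.+1) p :
  root_split M -> root_split (horner_mx M p).
Proof.
move=> [s s0]; exists [seq p.[a] | a <- s].
have -> : horner_mx (horner_mx M p)
  (\prod_(b <- [seq p.[a] | a <- s]) ('X - b%:P)) =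
          horner_mx M (\prod_(a <- s) (p - p.[a]%:P)).
  rewrite big_map !rmorph_prod; apply: eq_bigr => a _.
  by rewrite !rmorphB/= horner_mx_X !horner_mx_C.
have /dvdpP[q ->] : \prod_(a <- s) ('X - a%:P) %| \prod_(a <- s) (p - p.[a]%:P).
  elim: {s0}s => [|a s IHs]; first by rewrite !big_nil.
  rewrite !big_cons dvdp_mul//.
  by rewrite dvdp_XsubCl rootE hornerD hornerN hornerC subrr.
by rewrite rmorphM/= s0 mulr0.
Qed.

Lemma root_split_conjmx (F : fieldType) m n (V : 'M[F]_(m.+1, n.+1)) M :
  row_free V -> stablemx V M -> root_split M -> root_split (conjmx V M).
Proof.
by move=> fV sV [s s0]; exists s; rewrite horner_mx_conj// s0 conjmx0.
Qed.

(** * Nilpotent pencils *)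

Lemma poly_eq0_of_horner (F : numFieldType) (p : {poly F}) :
  (forall t, p.[t] = 0) -> p = 0.
Proof.
move=> p0; apply/eqP/negPn/negP => pN0.
pose rs : seq F := [seq i%:R | i <- iota 0 (size p)].
have rsp : all (root p) rs by apply/allP => x _; rewrite rootE p0.
have urs : uniq rs.
  by rewrite map_inj_uniq ?iota_uniq// => i j /eqP; rewrite eqr_nat => /eqP.
by have := max_poly_roots pN0 rsp urs; rewrite size_map size_iota ltnn.
Qed.

(** [k.+1] is the largest nilpotency index in the pencil, and [t0] attains it. *)
Lemma nilpotent_pencil (F : fieldType) n (X Y : 'M[F]_n.+1) a b :
    GRing.comm X Y -> X ^+ a = 0 -> Y ^+ b = 0 ->
  exists k t0, (forall t, (Y + t *: X) ^+ k.+1 = 0) /\ (Y + t0 *: X) ^+ k != 0.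
Proof.
move=> cXY Xa Yb.
have : exists K, forall t, (Y + t *: X) ^+ K = 0.
  exists (a + b)%N => t; rewrite exprDn_comm; last first.
    by rewrite /GRing.comm -scalerAr -scalerAl cXY.
  apply: big1 => i _; rewrite exprZn; case: (leqP a i) => ai.
    have -> : X ^+ i = X ^+ (i - a) * X ^+ a by rewrite -exprD subnK.
    by rewrite Xa mulr0 scaler0 mulr0 mul0rn.
  have bi : (b <= a + b - i)%N by rewrite -addnBAC ?leq_addl// ltnW.
  by rewrite -(subnK bi) exprD Yb mulr0 mul0r mul0rn.
case=> K; elim: K => [|K IHK] K0.
  by have /eqP := K0 0; rewrite expr0 oner_eq0.
have [/IHK//|/existsNP[t0 /eqP t00]] :=
  pselect (forall t, (Y + t *: X) ^+ K = 0).
by exists K, t0.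
Qed.

(** The coefficient of [t] in [(Y + t X)^(k+1)] is [(k + 1) Y^k X]. *)
Lemma pencil_top_power (F : numFieldType) n (X Y : 'M[F]_n.+1) k :
    GRing.comm X Y -> (forall t, (Y + t *: X) ^+ k.+1 = 0) -> Y ^+ k * X = 0.
Proof.
move=> cXY K0; apply/matrixP => i j; rewrite [RHS]mxE.
pose c l : F := ((Y ^+ (k.+1 - l) * X ^+ l) *+ 'C(k.+1, l)) i j.
have P0 : \poly_(l < k.+2) c l = 0.
  apply: poly_eq0_of_horner => t; rewrite horner_poly.
  transitivity (((Y + t *: X) ^+ k.+1) i j); last by rewrite K0 mxE.
  rewrite exprDn_comm; last by rewrite /GRing.comm -scalerAr -scalerAl cXY.
  rewrite summxE; apply: eq_bigr => l _.
  by rewrite /c exprZn -scalerAr scalerMnr [RHS]mxE mulrC.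
have := congr1 (fun p : {poly F} => p`_1) P0.
rewrite coef_poly coef0 /= /c subSS subn0 expr1 bin1 -mulr_natr mulr_natr
  mulmxnE.
by move/eqP; rewrite mulrn_eq0/= => /eqP.
Qed.

(** Polarization: a symmetric form that vanishes on the diagonal is zero. *)
Lemma symmetric_anisotropic (F : numFieldType) n (S : 'M[F]_n) :
  S^T = S -> S != 0 -> exists v : 'rV_n, (v *m S *m v^T) 0 0 != 0.
Proof.
move=> sS SN0; apply: contrapT => /forallNP v0.
have {}v0 (v : 'rV_n) : (v *m S *m v^T) 0 0 = 0.
  by apply/eqP/negPn/negP => /v0.
have E (i j : 'I_n) :
  ((delta_mx 0 i : 'rV_n) *m S *m (delta_mx 0 j : 'rV_n)^T) 0 0 = S i j.
  by rewrite -rowE trmx_delta -colE !mxE.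
have Sd i : S i i = 0 by rewrite -E v0.
have Sji i j : S j i = S i j by rewrite -{1}sS mxE.
case/eqP: SN0; apply/matrixP => i j; rewrite [RHS]mxE.
have := v0 (delta_mx 0 i + delta_mx 0 j).
have DE (M N : 'M[F]_1) : (M + N) 0 0 = M 0 0 + N 0 0 by rewrite mxE.
rewrite linearD/= mulmxDl mulmxDr !mulmxDl !DE !E !Sd Sji add0r addr0 => /eqP.
by rewrite -mulr2n mulrn_eq0/= => /eqP.
Qed.

Lemma mul_rank_one (F : fieldType) m n (G : 'M[F]_n) (x : 'M[F]_(m, n))
  (v : 'rV_n) :
  x *m (G *m v^T *m v) = (x *m G *m v^T) *m v.
Proof. by rewrite !mulmxA. Qed.

(** * Perturbation by the derivative of a power *)

Section CyclicDirection.
Variables (F : fieldType) (n : nat) (G X Y : 'M[F]_n.+1) (k : nat)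
  (v : 'rV[F]_n.+1).
Hypotheses (sG : G^T = G) (sY : selfadj G Y).
Hypotheses (cXY : GRing.comm X Y) (Yk : Y ^+ k.+1 = 0) (YkX : Y ^+ k * X = 0).

(** The derivative of [Y |-> Y^(k+1)] in the direction of the rank-one matrix
    [G v^T v]. *)
Definition cyclic_dir : 'M[F]_n.+1 :=
  \sum_(i < k.+1) Y ^+ i *m (G *m v^T *m v) *m Y ^+ (k - i).

Lemma selfadj_cyclic_dir : selfadj G cyclic_dir.
Proof.
rewrite /selfadj /cyclic_dir mulmx_suml linear_sum/=.
rewrite (reindex_inj rev_ord_inj)/=; apply: eq_bigr => i _.
have E j l : Y ^+ j *m (G *m v^T *m v) *m Y ^+ l *m G =
             Y ^+ j *m (G *m v^T *m v *m G) *m (Y ^+ l)^T.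
  by rewrite -mulmxA -(selfadjE sG (selfadjX l sG sY)) !mulmxA.
rewrite !E subSS subKn ?leq_ord// !trmx_mul !trmxK sG.
by rewrite !mulmxA.
Qed.

(** The commutator telescopes to [Y^(k+1) T - T Y^(k+1)] with [T = G v^T v]. *)
Lemma cyclic_dir_comm : GRing.comm Y cyclic_dir.
Proof.
rewrite /GRing.comm /cyclic_dir mulr_sumr mulr_suml.
pose f i := Y ^+ i *m (G *m v^T *m v) *m Y ^+ (k.+1 - i).
have -> : \sum_(i < k.+1) Y * (Y ^+ i *m (G *m v^T *m v) *m Y ^+ (k - i)) =
          \sum_(i < k.+1) f i.+1.
  apply: eq_bigr => i _; rewrite /f subSS exprS -!mulmxE.
  by rewrite !mulmxA.
have -> : \sum_(i < k.+1) Y ^+ i *m (G *m v^T *m v) *m Y ^+ (k - i) * Y =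
          \sum_(i < k.+1) f i.
  apply: eq_bigr => i _; rewrite /f subSn ?leq_ord// exprSr -!mulmxE.
  by rewrite !mulmxA.
have f0 : f 0%N = 0 by rewrite /f subn0 Yk mulmx0.
have fk : f k.+1 = 0 by rewrite /f Yk !mul0mx.
transitivity (\sum_(i < k.+2) f i).
  by rewrite [RHS]big_ord_recl/= f0 add0r.
by rewrite big_ord_recr/= fk addr0.
Qed.

Let w := v *m Y ^+ k.
Let g := (v *m Y ^+ k *m G *m v^T) 0 0.
Hypothesis gN0 : g != 0.

Let wY : w *m Y = 0.
Proof. by rewrite /w -mulmxA mulmxE -exprSr Yk mulmx0. Qed.

Let wX : w *m X = 0.
Proof. by rewrite /w -mulmxA mulmxE YkX mulmx0. Qed.

(** Only the term with no power of [Y] on the left survives on the kernel of [Y]. *)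
Lemma ker_cyclic_dir m (u : 'M[F]_(m, n.+1)) :
  u *m Y = 0 -> u *m cyclic_dir = (u *m G *m v^T) *m w.
Proof.
move=> uY; rewrite /cyclic_dir big_ord_recl mulmxDr subn0 expr0 mul1mx.
rewrite mulmxA mul_rank_one -mulmxA -/w mulmx_sumr big1 ?addr0// => i _.
by rewrite lift0 exprS -mulmxE !mulmxA uY !mul0mx.
Qed.

Variables (e : F) (m : nat).
Hypotheses (eN0 : e != 0) (Xm : X ^+ m = 0).
Let N := X + e *: cyclic_dir.

Let NY : N *m Y = Y *m N.
Proof.
by rewrite /N mulmxDl mulmxDr -scalemxAl -scalemxAr !mulmxE cXY cyclic_dir_comm.
Qed.

Let wN : w *m N = (e * g) *: w.
Proof.
rewrite /N mulmxDr wX add0r -scalemxAr ker_cyclic_dir//.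
by rewrite [_ *m G *m _]mx11_scalar mul_scalar_mx scalerA.
Qed.

(* On the kernel of [Y], modulo the line of [w], [N] acts as the nilpotent [X]. *)
Let kerYN r (u : 'M[F]_(r, n.+1)) j :
  u *m Y = 0 -> exists c : 'cV_r, u *m N ^+ j = u *m X ^+ j + c *m w.
Proof.
move=> uY; elim: j => [|j [c IHj]].
  by exists 0; rewrite mul0mx addr0.
exists (e *: (u *m X ^+ j *m G *m v^T) + (e * g) *: c).
rewrite exprSr -mulmxE mulmxA IHj mulmxDl -[c *m w *m N]mulmxA wN.
rewrite {1}/N mulmxDr -scalemxAr ker_cyclic_dir; last first.
  have cXjY : GRing.comm (X ^+ j) Y by apply/commr_sym/commrX/commr_sym.
  by rewrite -mulmxA mulmxE cXjY -mulmxE mulmxA uY mul0mx.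
rewrite -mulmxA mulmxE -exprSr -addrA; congr (_ + _).
by rewrite mulmxDl -!scalemxAl -scalemxAr.
Qed.

Let f := 'X^m * ('X - (e * g)%:P).

Let kerYf r (u : 'M[F]_(r, n.+1)) : u *m Y = 0 -> u *m horner_mx N f = 0.
Proof.
move=> uY; rewrite /f rmorphM rmorphXn rmorphB/= horner_mx_X horner_mx_C
  -mulmxE mulmxA.
have [c ->] := kerYN m uY.
by rewrite Xm mulmx0 add0r -mulmxA mulmxBr wN mul_mx_scalar subrr mulmx0.
Qed.

(* [N] commutes with [Y], so that one factor [f(N)] can be spent on each step of
   the filtration of the space by the kernels of the powers of [Y]. *)
Let kerYXf r (u : 'M[F]_(r, n.+1)) j : u *m Y ^+ j = 0 ->
  u *m (horner_mx N f) ^+ j = 0.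
Proof.
elim: j u => [|j IHj] u; first by rewrite !mulmx1.
rewrite exprS -mulmxE mulmxA => /IHj; rewrite -mulmxA => uYf.
rewrite exprSr -mulmxE mulmxA; apply: kerYf.
rewrite -mulmxA -[RHS]uYf; congr (_ *m _).
apply/commr_sym/commrX/comm_mx_horner/esym; exact: NY.
Qed.

Let fNk : (horner_mx N f) ^+ k.+1 = 0.
Proof. by rewrite -[LHS]mul1mx; apply: kerYXf; rewrite Yk mulmx0. Qed.

(** [X + e Z] is annihilated by a power of ['X^m * ('X - e g)]. *)
Lemma root_split_cyclic_dir : root_split (X + e *: cyclic_dir).
Proof.
apply: (@root_split_exp _ _ _ (rcons (nseq m 0) (e * g)) k.+1).
rewrite -cats1 big_cat big_seq1 big_nseq/= iter_mulr_1 subr0 rmorphXn.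
exact: fNk.
Qed.

(** The eigenvalue [e g] occurs, with eigenvector [w].  If [0] did not, [N] would be
    invertible; but [N ^+ m] maps the kernel of [Y] into the line of [w], so this
    kernel would have dimension at most one, and [Y] would be a single Jordan
    block, of nilpotency index the dimension. *)
Lemma decomposable_cyclic_dir : (k < n)%N -> decomposable (X + e *: cyclic_dir).
Proof.
move=> kn; pose p : {poly F} := 'X^m ^+ k.+1.
pose q := ('X - (e * g)%:P) ^+ k.+1.
have egN0 : e * g != 0 by rewrite mulf_neq0.
have cXe : coprimep 'X ('X - (e * g)%:P).
  by rewrite -[X in coprimep X _]subr0 coprimep_XsubC root_XsubC.
exists p, q; split.
- by rewrite coprimep_expl// coprimep_expr// coprimep_expl.
- by rewrite -exprMn rmorphXn; exact: fNk.
- have wNj j : w *m N ^+ j = (e * g) ^+ j *: w.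
    elim: j => [|j IHj]; first by rewrite mulmx1 scale1r.
    by rewrite exprSr -mulmxE mulmxA IHj -scalemxAl wN scalerA -exprSr.
  apply: contra_neq gN0 => p0.
  have := wNj (m * k.+1)%N.
  have -> : N ^+ (m * k.+1) = 0
    by rewrite -[RHS]p0 !rmorphXn/= horner_mx_X exprM.
  rewrite mulmx0 => /esym/eqP; rewrite scaler_eq0 expf_eq0 (negPf egN0) andbF/=.
  by rewrite /g -/w => /eqP ->; rewrite !mul0mx mxE.
apply: contraL kn => /eqP q0; rewrite -leqNgt.
have uN : N \in unitmx.
  rewrite -[N]horner_mx_X; apply: coprimep_horner_unit q0.
  by rewrite coprimep_sym coprimep_expr.
have rkY : (n <= \rank Y)%N.
  have [c] := kerYN m (mulmx_ker Y); rewrite Xm mulmx0 add0r => Kc.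
  have : (\rank (kermx Y) <= 1)%N.
    rewrite -(@mxrankMfree _ _ _ _ (kermx Y) (N ^+ m)) ?row_free_unit ?unitrX//.
    by rewrite Kc; apply: leq_trans (mxrankM_maxr _ _) (rank_leq_row _).
  by rewrite mxrank_ker leq_subLR addn1.
(* Sylvester's rank inequality: each factor [Y] lowers the rank by at most one. *)
have rkYj j : (n.+1 <= \rank (Y ^+ j) + j)%N.
  elim: j => [|j IHj]; first by rewrite expr0 mxrank1 addn0.
  rewrite exprSr -mulmxE.
  have := mxrank_mul_min (Y ^+ j) Y; lia.
by have := rkYj k.+1; rewrite Yk mxrank0 add0n.
Qed.

End CyclicDirection.

(** * Perturbation of a cyclic nilpotent matrix *)

(** The vectors [v Y^i] span the space, because their matrix of products with the
    [v Y^j] is triangular with an invertible diagonal.  So [v X = v p(Y)] for some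
    polynomial [p], and [X - p(Y)], which commutes with [Y], kills all of them. *)
Lemma cyclic_commutant (F : fieldType) n (G X Y : 'M[F]_n.+1) k (v : 'rV_n.+1) :
    (n <= k)%N -> Y ^+ k.+1 = 0 -> (v *m Y ^+ k *m G *m v^T) 0 0 != 0 ->
    GRing.comm X Y -> exists p, X = horner_mx Y p.
Proof.
move=> nk Yk gN0 cXY.
have Y0 j : (k < j)%N -> Y ^+ j = 0.
  by move=> kj; rewrite -(subnK kj) exprD Yk mulr0.
(* The rows of [W] are listed by decreasing power of [Y], which makes [W *m M]
   lower triangular. *)
pose W : 'M[F]_(k.+1, n.+1) := \matrix_(i < k.+1) (v *m Y ^+ (k - i)).
pose M : 'M[F]_(n.+1, k.+1) := (\matrix_(j < k.+1) (Y ^+ j *m G *m v^T)^T)^T.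
have WM i j : (W *m M) i j = (v *m Y ^+ (k - i + j) *m G *m v^T) 0 0.
  transitivity ((row i W *m col j M) 0 0).
    by rewrite !mxE; apply: eq_bigr => l _; rewrite !mxE.
  by rewrite rowK -tr_row rowK trmxK exprD -mulmxE !mulmxA.
have uWM : W *m M \in unitmx.
  rewrite unitmxE det_trig; last first.
    apply/is_trig_mxP => i j ij; rewrite WM Y0 ?mulmx0 ?mul0mx ?mxE//.
    have := ltn_ord i; lia.
  rewrite unitfE; apply/prodf_neq0 => i _.
  by rewrite WM subnK// -ltnS.
have fW : row_full W.
  rewrite /row_full eqn_leq rank_leq_col /=.
  apply: leq_trans (mxrankM_maxl W M).
  by rewrite mxrank_unit.
have /submxP[c vX] : (v *m X <= W)%MS by rewrite submx_full.
pose p := \sum_(i < k.+1) (c 0 i) *: 'X^(k - i).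
have vp : v *m X = v *m horner_mx Y p.
  rewrite vX mulmx_sum_row /p linear_sum mulmx_sumr; apply: eq_bigr => i _.
  by rewrite linearZ/= rmorphXn/= horner_mx_X -scalemxAr rowK.
exists p; apply/eqP; rewrite -subr_eq0; apply/eqP.
apply: (row_full_inj fW); rewrite mulmx0; apply/row_matrixP => i.
rewrite row_mul rowK row0 -mulmxA mulmxE.
have cE : GRing.comm (X - horner_mx Y p) (Y ^+ (k - i)).
  apply/commrX/commr_sym/commrB; first exact: commr_sym.
  exact: comm_mx_horner.
by rewrite -cE -mulmxE mulmxA mulmxBr vp subrr mul0mx.
Qed.

Lemma real_quadratic_roots (R : rcfType) (b c : R) : 0 < b ^+ 2 + 4 * c ->
  exists r s, [/\ r != 0, r != s, r + s = b & r * s = - c].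
Proof.
move=> D0; pose d := Num.sqrt (b ^+ 2 + 4 * c).
have d0 : 0 < d by rewrite sqrtr_gt0.
have d2 : d ^+ 2 = b ^+ 2 + 4 * c by rewrite sqr_sqrtr// ltW.
pose r := (b + d) / 2; pose s := (b - d) / 2.
have rs : r != s by rewrite /r /s; apply/eqP => rs; lra.
have sum : r + s = b by rewrite /r /s; field.
have prod : r * s = - c.
  have -> : r * s = (b ^+ 2 - d ^+ 2) / 4 by rewrite /r /s; field.
  by rewrite d2; field.
have [r0|rN0] := eqVneq r 0; last by exists r, s.
by exists s, r; rewrite -{1}r0 eq_sym rs addrC mulrC.
Qed.

Section CyclicCase.
Variables (R : rcfType) (n : nat) (G Y : 'M[R]_n.+1) (k : nat)
  (v : 'rV[R]_n.+1).
Hypotheses (sG : G^T = G) (sY : selfadj G Y) (Yk : Y ^+ k.+1 = 0)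
  (k_gt0 : (0 < k)%N).
Let form j := (v *m Y ^+ j *m G *m v^T) 0 0.
Hypothesis gN0 : form k != 0.

Let u := v *m Y ^+ k./2.
Let g := form (k./2 + k./2).
Let c := form (k./2 + k./2).+1.

(** With the exponent [k./2] in [u], the products of [u] with the [u Y^j] vanish for
    [j >= 2], while the one for [j = 0], if [k] is even, or for [j = 1], if [k] is
    odd, is [form k], which is nonzero. *)
Definition splitting_dir : 'M[R]_n.+1 := G *m u^T *m u.

Lemma selfadj_splitting_dir : selfadj G splitting_dir.
Proof.
rewrite /selfadj /splitting_dir; move: (u) => w.
by rewrite !trmx_mul trmxK sG !mulmxA.
Qed.

Let Y0 j : (k < j)%N -> Y ^+ j = 0.
Proof. by move=> kj; rewrite -(subnK kj) exprD Yk mulr0. Qed.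

Let Gu (x : 'rV_n.+1) : x *m G *m u^T = x *m Y ^+ k./2 *m G *m v^T.
Proof.
rewrite /u trmx_mul mulmxA -[x *m G *m _]mulmxA selfadjE ?mulmxA//.
exact: selfadjX.
Qed.

Let uYGu j : (u *m Y ^+ j *m G *m u^T) = (form (k./2 + k./2 + j))%:M.
Proof.
rewrite [LHS]mx11_scalar Gu /u /form; congr ((_ *m _ *m _) 0 0)%:M.
rewrite -!mulmxA !mulmxE -!exprD; congr (_ *m _ ^+ _); lia.
Qed.

Variable e : R.
(* The sign of [e] is chosen so that the discriminant below is positive. *)
Hypotheses (eN0 : e != 0) (ec : 0 <= e * c).
Let N := Y + e *: splitting_dir.

Let disc_gt0 : 0 < (e * g) ^+ 2 + 4 * (e * c).
Proof.
have [ok|ek] := boolP (odd k).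
  have ck : c = form k.
    by rewrite /c; congr form; have := odd_double_half k; lia.
  rewrite ltr_wpDl ?sqr_ge0// mulr_gt0// lt_neqAle ec andbT eq_sym.
  by rewrite mulf_neq0// ck.
have gk : g = form k by rewrite /g; congr form; have := odd_double_half k; lia.
rewrite ltr_wpDr//; first exact: mulr_ge0.
by rewrite exprn_even_gt0//= gk mulf_neq0.
Qed.

(** With [h = 'X^2 - e g 'X - e c = ('X - r1) * ('X - r2)] one finds
    [u h(N) = u Y^2], which a power of [N] kills; and [N H = Y H] as soon as
    [u H = 0], so [N^(2k+2) h(N) = 0].  The nonzero root [r1] is an
    eigenvalue, with eigenvector [- u (Y - r1)^-1], and it is not the only one:
    otherwise [N] would be the scalar [r1], so [u] would be an eigenvector of
    [Y], whereas [u Y != 0]. *)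
Lemma splitting_dir_splits : root_split N /\ decomposable N.
Proof.
have [r1 [r2 [r1N0 r12 sum prod]]] := real_quadratic_roots disc_gt0.
have dirE (x : 'rV_n.+1) : x *m N = x *m Y + e *: (x *m G *m u^T *m u).
  by rewrite /N mulmxDr -scalemxAr /splitting_dir !mulmxA.
have uN : u *m N = u *m Y + (e * g) *: u.
  have := uYGu 0; rewrite mulmx1 addn0 dirE => ->.
  by rewrite mul_scalar_mx scalerA.
have uYN : u *m Y *m N = u *m Y ^+ 2 + (e * c) *: u.
  have := uYGu 1; rewrite expr1 addn1 dirE => ->.
  by rewrite mul_scalar_mx scalerA -[u *m Y *m Y]mulmxA mulmxE -expr2.
have form0 j : (k < j)%N -> form j = 0.
  by move=> kj; rewrite /form Y0// mulmx0 !mul0mx mxE.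
have uYj j : u *m Y ^+ 2 *m N ^+ j = u *m Y ^+ (2 + j).
  elim: j => [|j IHj]; first by rewrite mulmx1 addn0.
  rewrite [N ^+ _]exprSr -mulmxE mulmxA IHj dirE uYGu form0; last first.
    have := odd_double_half k; lia.
  by rewrite raddf0 mul0mx scaler0 addr0 addnS [in RHS]exprSr -mulmxE mulmxA.
have uh : u *m (N - r2%:M) *m (N - r1%:M) = u *m Y ^+ 2.
  have -> : u *m (N - r2%:M) = u *m Y + r1 *: u.
    by rewrite mulmxBr uN mul_mx_scalar -addrA -scalerBl -sum addrK.
  rewrite mulmxBr mulmxDl uYN -scalemxAl uN mul_mx_scalar !scalerDr !scalerA.
  have -> : e * c = r1 * r1 - r1 * (e * g) by rewrite -[LHS]opprK -prod -sum;
    ring.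
  rewrite scalerBl; apply/eqP; rewrite subr_eq -addrA; apply/eqP; congr (_ + _).
  by rewrite addrACA addNr addr0 addrC.
have NH j (H : 'M[R]_n.+1) : u *m H = 0 -> GRing.comm N H ->
  N ^+ j * H = Y ^+ j * H.
  move=> uH cNH.
  have NYH : N * H = Y * H.
    have TH : splitting_dir *m H = 0
      by rewrite /splitting_dir -[LHS]mulmxA uH mulmx0.
    by rewrite /N mulrDl -scalerAl -!mulmxE TH scaler0 addr0.
  have cH i : H * N ^+ i = N ^+ i * H by apply/commrX/commr_sym.
  elim: j => [|j IHj]; first by rewrite !expr0.
  by rewrite exprSr -mulrA NYH exprSr -[in RHS]mulrA -NYH cNH !mulrA IHj
    -!mulrA -!cNH.
pose p := 'X^(k.+1 + k.+1) * ('X - r2%:P).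
have evX r : horner_mx N ('X - r%:P) = N - r%:M.
  by rewrite rmorphB/= horner_mx_X horner_mx_C.
have evXn j : horner_mx N 'X^j = N ^+ j by rewrite rmorphXn/= horner_mx_X.
have H0 : horner_mx N (p * ('X - r1%:P)) = 0.
  pose h := ('X - r2%:P) * ('X - r1%:P) * 'X^(k.+1).
  have -> : p * ('X - r1%:P) = 'X^(k.+1) * h by rewrite /p /h exprD; ring.
  rewrite rmorphM/= evXn NH ?Yk ?mul0r//.
    rewrite /h !rmorphM/= evXn !evX -!mulmxE !mulmxA uh uYj /u -mulmxA mulmxE
      -exprD.
    by rewrite Y0 ?mulmx0//; lia.
  by apply: comm_mx_horner.
split.
  exists (nseq (k.+1 + k.+1) 0 ++ [:: r2; r1]).
  rewrite big_cat big_nseq iter_mulr_1 subr0 big_cons big_seq1/= mulrA.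
  exact: H0.
have uN0 : u != 0.
  apply: contra_neq gN0 => u0; rewrite /form.
  have kk : (k./2 <= k)%N by have := odd_double_half k; lia.
  by rewrite -(subnKC kk) exprD -mulmxE mulmxA -/u u0 !mul0mx mxE.
exists p, ('X - r1%:P); split => //.
- rewrite coprimep_XsubC /p rootE hornerM hornerXn hornerXsubC mulf_neq0//.
    by rewrite expf_neq0.
  by rewrite subr_eq0.
(* Below, [z] is an eigenvector of [N] for [r1]: [z Y = r1 z - u], and the missing
   [u] is supplied by the perturbation, as [e (z G u^T) = 1] because [r1] is a
   root of [h]. *)
- pose D := Y - r1%:M.
  have uD : D \in unitmx.
    have -> : D = horner_mx Y ('X - r1%:P)
      by rewrite rmorphB/= horner_mx_X horner_mx_C.
    apply: (@coprimep_horner_unit _ _ _ 'X^(k.+1)).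
      by rewrite coprimep_expl//
        -[X in coprimep X _]subr0 coprimep_XsubC root_XsubC.
    by rewrite rmorphXn/= horner_mx_X.
  have cDY j : GRing.comm D (Y ^+ j).
    apply/commrX/commr_sym/commrB => //; exact: comm_mx_scalar.
  pose z := - u *m invmx D.
  have zD : z *m D = - u by rewrite /z mulmxKV.
  have zY : z *m Y = r1 *: z - u.
    have := zD; rewrite mulmxBr mul_mx_scalar => /eqP.
    by rewrite subr_eq addrC => /eqP.
  pose s (x : 'rV_n.+1) := (x *m G *m u^T) 0 0.
  have sB x y a : s (a *: x - y) = a * s x - s y.
    by rewrite /s !mulmxBl -!scalemxAl !mxE.
  have sE x : x *m G *m u^T = (s x)%:M by rewrite {1}[LHS]mx11_scalar.
  have su : s u = g by have := uYGu 0; rewrite mulmx1 addn0 sE =>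
    /(congr1 (fun M : 'M[R]_1 => M 0 0)); rewrite !mxE.
  have suY : s (u *m Y) = c by have := uYGu 1; rewrite expr1 addn1 sE =>
    /(congr1 (fun M : 'M[R]_1 => M 0 0)); rewrite !mxE.
  have szYY : s (z *m Y *m Y) = 0.
    rewrite /s Gu.
    have -> : z *m Y *m Y *m Y ^+ k./2 = z *m Y ^+ k./2.+2.
      by rewrite -!mulmxA !mulmxE -!exprS.
    have -> : z *m Y ^+ k./2.+2 = 0.
      suff e0 : z *m Y ^+ k./2.+2 *m D = 0
        by rewrite -[LHS](mulmxK uD) e0 mul0mx.
      rewrite -mulmxA mulmxE -cDY -mulmxE mulmxA zD mulNmx /u -mulmxA mulmxE
        -exprD.
      by rewrite Y0 ?mulmx0 ?oppr0//; have := odd_double_half k; lia.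
    by rewrite !mul0mx mxE.
  have sz : e * s z = 1.
    have e1 : s (z *m Y *m Y) = r1 * (r1 * s z - g) - c.
      by rewrite {1}zY mulmxBl -scalemxAl sB suY zY sB su.
    have r11 : r1 ^+ 2 = e * (r1 * g + c).
      have -> : e * (r1 * g + c) = r1 * (e * g) + e * c by ring.
      by rewrite -sum -[e * c]opprK -prod; ring.
    have e2 : r1 ^+ 2 * (e * s z - 1) = 0.
      have -> : r1 ^+ 2 * (e * s z - 1) = e * (r1 * (r1 * s z - g) - c) +
          (e * (r1 * g + c) - r1 ^+ 2) by ring.
      by rewrite -e1 szYY -r11; ring.
    move/eqP: e2; rewrite mulf_eq0 expf_eq0/= (negPf r1N0) /= subr_eq0.
    by move/eqP.
  have zN : z *m N = r1 *: z.
    by rewrite dirE zY sE mul_scalar_mx scalerA sz scale1r subrK.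
  have zN0 : z != 0.
    by apply: contra_neq uN0 => z0; rewrite -[LHS]opprK -zD z0 mul0mx oppr0.
  have zNj j : z *m N ^+ j = r1 ^+ j *: z.
    elim: j => [|j IHj]; first by rewrite mulmx1 scale1r.
    by rewrite exprSr -mulmxE mulmxA IHj -scalemxAl zN scalerA -exprSr.
  apply: contra_neq zN0 => p0.
  have : z *m horner_mx N p = 0 by rewrite p0 mulmx0.
  rewrite rmorphM/= evXn evX -mulmxE mulmxA zNj -scalemxAl mulmxBr zN
    mul_mx_scalar.
  rewrite -scalerBl scalerA => /eqP; rewrite scaler_eq0 mulf_eq0 subr_eq0
    (negPf r12).
  by rewrite expf_eq0 (negPf r1N0) andbF => /eqP.
rewrite evX subr_eq0; apply: contra_neq uN0 => Nr1.
have uYr : u *m Y = (r1 - e * g) *: u.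
  by rewrite scalerBl -mul_mx_scalar -Nr1 uN addrK.
have uYrj j : u *m Y ^+ j = (r1 - e * g) ^+ j *: u.
  elim: j => [|j IHj]; first by rewrite mulmx1 scale1r.
  by rewrite exprSr -mulmxE mulmxA IHj -scalemxAl uYr scalerA -exprSr.
have := uYrj k.+1; rewrite Yk mulmx0 => /esym/eqP; rewrite scaler_eq0 =>
  /orP[|/eqP//].
rewrite expf_eq0/= => /eqP r0.
have uY0 : u *m Y = 0 by rewrite uYr r0 scale0r.
case/eqP: gN0; rewrite /form.
have -> : k = (k./2.+1 + (k - k./2.+1))%N by have := odd_double_half k; lia.
by rewrite exprD exprSr -!mulmxE !mulmxA -/u uY0 !mul0mx mxE.
Qed.

End CyclicCase.

(** * Limits of matrices *)

Lemma closure_map (T U : topologicalType) (f : T -> U) (D : set T)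
  (E : set U) x :
  f y @[y --> x] --> f x -> (forall y, D y -> closure E (f y)) ->
  closure D x -> closure E (f x).
Proof.
move=> fx DE Dx B /nbhs_interior/fx/Dx[y [Dy By]].
exact: DE Dy _ By.
Qed.

Lemma closureX (T U : topologicalType) (D : set T) (E : set U) x y :
  closure D x -> closure E y -> closure (D `*` E) (x, y).
Proof.
move=> Dx Ey B [[B1 B2] /= [xB1 yB2] BB].
have [[x' [Dx' Bx']] [y' [Ey' By']]] := (Dx _ xB1, Ey _ yB2).
by exists (x', y'); split => //; exact: BB.
Qed.

Lemma cvg_to_pair (T : Type) (U V : topologicalType) (F : set_system T)
    {FF : Filter F} (f : T -> U) (g : T -> V) (a : U) (b : V) :
  f x @[x --> F] --> a -> g x @[x --> F] --> b ->
  (f x, g x) @[x --> F] --> (a, b).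
Proof. by move=> fa gb; exact: cvg_pair fa gb. Qed.

Section MatrixConvergence.
Variables (K : numFieldType) (T : Type) (F : set_system T).
Context {FF : Filter F}.

Lemma cvg_mx m n (f : T -> 'M[K]_(m, n)) (a : 'M[K]_(m, n)) :
  (forall i j, f x i j @[x --> F] --> a i j) -> f x @[x --> F] --> a.
Proof.
move=> fa B [P aP PB]; apply:
  (@filterS _ _ _ (fun x => forall i j, P i j (f x i j))).
  by move=> x; exact: PB.
apply: filter_forall => i; apply: filter_forall => j.
exact: fa (aP i j).
Qed.

Lemma cvg_mx_entry m n (f : T -> 'M[K]_(m, n)) (a : 'M[K]_(m, n)) i j :
  f x @[x --> F] --> a -> f x i j @[x --> F] --> a i j.
Proof.
move=> fa; apply: (@cvg_comp _ _ _ f (fun M : 'M[K]_(m, n) => M i j) _ _ _ fa).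
exact: coord_continuous.
Qed.

Lemma cvg_mulmx m n p (f : T -> 'M[K]_(m, n)) (g : T -> 'M[K]_(n, p))
  (a : 'M[K]_(m, n)) (b : 'M[K]_(n, p)) :
  f x @[x --> F] --> a -> g x @[x --> F] --> b ->
  f x *m g x @[x --> F] --> a *m b.
Proof.
move=> fa gb; apply: cvg_mx => i j; rewrite mxE.
under eq_fun do rewrite mxE.
apply: cvg_big => [|l _]; first exact: add_continuous.
by apply: cvgM; exact: cvg_mx_entry.
Qed.

Lemma cvg_horner_mx n (f : T -> 'M[K]_n.+1) (a : 'M[K]_n.+1) p :
  f x @[x --> F] --> a -> horner_mx (f x) p @[x --> F] --> horner_mx a p.
Proof.
move=> fa; elim/poly_ind: p => [|p c IHp].
  by rewrite rmorph0; under eq_fun do rewrite rmorph0; exact: cvg_cst.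
rewrite rmorphD rmorphM/= horner_mx_X horner_mx_C -mulmxE.
under eq_fun do rewrite rmorphD rmorphM/= horner_mx_X horner_mx_C -mulmxE.
by apply: cvgD; [exact: cvg_mulmx|exact: cvg_cst].
Qed.

End MatrixConvergence.

(** * The closure of the set of simultaneously diagonal pairs *)

Section Closure.
Variable R : realType.

Definition diag_pairs n (G : 'M[R]_n) : set ('M[R]_n * 'M[R]_n) :=
  [set XY | exists2 Q, Q \in unitmx &
    [/\ is_diag_mx (Q *m G *m Q^T), is_diag_mx (Q *m XY.1 *m G *m Q^T)
      & is_diag_mx (Q *m XY.2 *m G *m Q^T)]].

Lemma diag_pairs_swap n (G X Y : 'M[R]_n) :
  closure (diag_pairs G) (X, Y) -> closure (diag_pairs G) (Y, X).
Proof.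
apply: (@closure_map _ _ (fun XY => (XY.2, XY.1)) _ _ (X, Y)) => /=.
  by apply: cvg_to_pair; [exact: cvg_snd|exact: cvg_fst].
by move=> XY [Q uQ [GQ XQ YQ]]; apply: subset_closure; exists Q.
Qed.

Lemma is_diag_mxD n (A B : 'M[R]_n) : is_diag_mx A -> is_diag_mx B ->
  is_diag_mx (A + B).
Proof.
move=> /is_diag_mxP dA /is_diag_mxP dB; apply/is_diag_mxP => i j ij.
by rewrite mxE dA// dB// addr0.
Qed.

Lemma is_diag_mxZ n (A : 'M[R]_n) a : is_diag_mx A -> is_diag_mx (a *: A).
Proof.
move=> /is_diag_mxP dA; apply/is_diag_mxP => i j ij.
by rewrite mxE dA// mulr0.
Qed.

(** An invertible affine change of the pair is a homeomorphism that preserves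
    simultaneous diagonality. *)
Lemma diag_pairs_affine n (G X Y : 'M[R]_n) a b t :
  closure (diag_pairs G) (X - a%:M, Y + t *: X - b%:M) ->
  closure (diag_pairs G) (X, Y).
Proof.
pose f (XY : 'M[R]_n * 'M[R]_n) :=
  (XY.1 + a%:M, XY.2 + b%:M - t *: (XY.1 + a%:M)).
have -> : (X, Y) = f (X - a%:M, Y + t *: X - b%:M)
  by rewrite /f /= !subrK addrK.
apply: closure_map.
  apply: cvg_to_pair => /=;
    [apply: cvgD|apply: cvgB;
      [apply: cvgD|apply: cvgZ; [exact: cvg_cst|apply: cvgD]]].
  - exact: cvg_fst.
  - exact: cvg_cst.
  - exact: cvg_snd.
  - exact: cvg_cst.
  - exact: cvg_fst.
  - exact: cvg_cst.
move=> XY [Q uQ [GQ XQ YQ]]; apply: subset_closure; exists Q => //.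
split => //=.
  rewrite mulmxDr !mulmxDl mul_mx_scalar -!scalemxAl.
  by apply: is_diag_mxD => //; exact: is_diag_mxZ.
rewrite -scaleNr !mulmxDr -!scalemxAr !mulmxDr !mul_mx_scalar !mulmxDl
  -!scalemxAl.
rewrite !mulmxDl -!scalemxAl.
apply: is_diag_mxD; first by apply: is_diag_mxD => //; exact: is_diag_mxZ.
by apply: is_diag_mxZ; apply: is_diag_mxD => //; exact: is_diag_mxZ.
Qed.

Lemma diag_pairs_limit n (G : 'M[R]_n) (f : R -> 'M[R]_n * 'M[R]_n) :
  f t @[t --> 0] --> f 0 -> (forall t, 0 < t -> closure (diag_pairs G) (f t)) ->
  closure (diag_pairs G) (f 0).
Proof.
move=> f0 ft; have := @closure_map R _ f [set t | 0 < t]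
  (diag_pairs G) 0 f0 ft; apply.
move=> B /nbhs_ballP[e /= e0 eB]; exists (e / 2); split; first exact: divr_gt0.
by apply: eB; rewrite /ball/= sub0r normrN gtr0_norm ?divr_gt0// ltr_pdivrMr//
  ltr_pMr// ltr1n.
Qed.

(** Approximations on two complementary orthogonal invariant subspaces are glued
    with [h], the endomorphism with given restrictions; orthogonality makes the
    union of diagonalizing bases of the parts diagonalize the forms. *)
Lemma diag_pairs_blocks n n1 n2 (G X Y : 'M[R]_n) (K1 : 'M[R]_(n1, n))
  (K2 : 'M[R]_(n2, n)) :
    (n = n1 + n2)%N -> G^T = G -> row_free (col_mx K1 K2) ->
    K1 *m G *m K2^T = 0 ->
    stablemx K1 X -> stablemx K2 X -> stablemx K1 Y -> stablemx K2 Y ->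
    closure (diag_pairs (K1 *m G *m K1^T)) (conjmx K1 X, conjmx K1 Y) ->
    closure (diag_pairs (K2 *m G *m K2^T)) (conjmx K2 X, conjmx K2 Y) ->
  closure (diag_pairs G) (X, Y).
Proof.
move=> en sG fK ort; subst n; rewrite row_free_unit in fK.
move=> sX1 sX2 sY1 sY2 D1 D2.
pose L1 := lsubmx (invmx (col_mx K1 K2)).
pose L2 := rsubmx (invmx (col_mx K1 K2)).
have KL : block_mx (K1 *m L1) (K1 *m L2) (K2 *m L1) (K2 *m L2) =
          block_mx 1%:M 0 0 1%:M.
  by rewrite -mul_col_row hsubmxK mulmxV// scalar_mx_block.
have [K11 K12 K21 K22] := eq_block_mx KL.
have LK : L1 *m K1 + L2 *m K2 = 1%:M by rewrite -mul_row_col hsubmxK mulVmx.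
have ort' : K2 *m G *m K1^T = 0 by apply: trmx_inj;
  rewrite !trmx_mul trmxK sG mulmxA ort trmx0.
pose h (Z1 : 'M[R]_n1) (Z2 : 'M[R]_n2) := L1 *m Z1 *m K1 + L2 *m Z2 *m K2.
have hK Z : stablemx K1 Z -> stablemx K2 Z -> Z = h (conjmx K1 Z) (conjmx K2 Z).
  move=> s1 s2; rewrite /h -[L1 *m _ *m _]mulmxA -[L2 *m _ *m _]mulmxA /conjmx.
  by rewrite !mulmxKpV// !mulmxA -mulmxDl LK mul1mx.
have cvg_h T (F : set_system T) (FF : Filter F) f1 f2 (Z1 : 'M[R]_n1)
  (Z2 : 'M[R]_n2) :
    f1 x @[x --> F] --> Z1 -> f2 x @[x --> F] --> Z2 ->
    h (f1 x) (f2 x) @[x --> F] --> h Z1 Z2.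
  move=> f1Z f2Z; apply: cvgD; apply: cvg_mulmx; try exact: cvg_cst.
    by apply: cvg_mulmx => //; exact: cvg_cst.
  by apply: cvg_mulmx => //; exact: cvg_cst.
have diag_h (Q1 : 'M[R]_n1) (Q2 : 'M[R]_n2) Z1 Z2 :
    is_diag_mx (Q1 *m Z1 *m (K1 *m G *m K1^T) *m Q1^T) ->
    is_diag_mx (Q2 *m Z2 *m (K2 *m G *m K2^T) *m Q2^T) ->
    is_diag_mx (col_mx (Q1 *m K1) (Q2 *m K2) *m h Z1 Z2 *m G *m
                (col_mx (Q1 *m K1) (Q2 *m K2))^T).
  move=> d1 d2.
  have hl : Q1 *m K1 *m h Z1 Z2 = Q1 *m Z1 *m K1.
    by rewrite -mulmxA /h mulmxDr !mulmxA K11 K12 !mul0mx addr0 mul1mx mulmxA.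
  have hr : Q2 *m K2 *m h Z1 Z2 = Q2 *m Z2 *m K2.
    by rewrite -mulmxA /h mulmxDr !mulmxA K21 K22 !mul0mx add0r mul1mx mulmxA.
  rewrite tr_col_mx mul_col_mx hl hr mul_col_mx mul_col_row is_diag_block_mx//
    !trmx_mul.
  have off0 p q r s (A : 'M[R]_(p, q)) (B : 'M[R]_(q, n1 + n2))
      (C : 'M[R]_(n1 + n2, r)) (D : 'M[R]_(r, s)) :
      B *m G *m C = 0 -> A *m B *m G *m (C *m D) = 0.
    move=> BC0; transitivity (A *m (B *m G *m C) *m D); first
      by rewrite !mulmxA.
    by rewrite BC0 mulmx0 mul0mx.
  by rewrite (off0 _ _ _ _ _ _ _ _ ort) (off0 _ _ _ _ _ _ _ _ ort');
    apply/and4P; split => //; move: d1 d2; rewrite !mulmxA.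
pose f (p : ('M[R]_n1 * 'M[R]_n1) * ('M[R]_n2 * 'M[R]_n2)) :=
  (h p.1.1 p.2.1, h p.1.2 p.2.2).
have -> : (X, Y) = f ((conjmx K1 X, conjmx K1 Y), (conjmx K2 X, conjmx K2 Y)).
  by rewrite /f /= -!hK.
apply: closure_map (closureX D1 D2).
  apply: cvg_to_pair; apply: cvg_h.
  - exact: (@cvg_comp _ _ _ fst fst _ _ _ cvg_fst cvg_fst).
  - exact: (@cvg_comp _ _ _ snd fst _ _ _ cvg_snd cvg_fst).
  - exact: (@cvg_comp _ _ _ fst snd _ _ _ cvg_fst cvg_snd).
  - exact: (@cvg_comp _ _ _ snd snd _ _ _ cvg_snd cvg_snd).
move=> [[X1 Y1] [X2 Y2]] [[Q1 uQ1 /= [GQ1 XQ1 YQ1]] [Q2 uQ2 /= [GQ2 XQ2 YQ2]]].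
apply: subset_closure; exists (col_mx (Q1 *m K1) (Q2 *m K2)).
  have -> : col_mx (Q1 *m K1) (Q2 *m K2) = block_mx Q1 0 0 Q2 *m col_mx K1 K2.
    by rewrite mul_block_col !mul0mx addr0 add0r.
  by rewrite unitmx_mul block_diag_mx_unit uQ1 uQ2.
split => /=; [|exact: diag_h|exact: diag_h].
have -> : G = h 1%:M 1%:M *m G by rewrite /h !mulmx1 LK mul1mx.
by rewrite [X in X *m _]mulmxA; apply: diag_h; rewrite mulmx1.
Qed.
End Closure.

(** * Density of the simultaneously diagonal pairs *)

Section Density.
Variable R : realType.

Definition admissible n (G X Y : 'M[R]_n.+1) :=
  [/\ G^T = G, G \in unitmx, selfadj G X, selfadj G Y & GRing.comm X Y] /\
  (root_split X /\ root_split Y).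

(** In a basis adapted to an orthogonal decomposition the Gram matrix is block
    diagonal, so the form stays nondegenerate on both parts. *)
Lemma unitmx_gram_blocks n n1 n2 (G : 'M[R]_n) (K1 : 'M[R]_(n1, n))
  (K2 : 'M[R]_(n2, n)) :
    n = (n1 + n2)%N -> G^T = G -> G \in unitmx -> row_free (col_mx K1 K2) ->
    K1 *m G *m K2^T = 0 ->
  K1 *m G *m K1^T \in unitmx /\ K2 *m G *m K2^T \in unitmx.
Proof.
move=> en sG uG fK ort; subst n; rewrite row_free_unit in fK.
have ort' : K2 *m G *m K1^T = 0 by apply: trmx_inj;
  rewrite !trmx_mul trmxK sG mulmxA ort trmx0.
apply/andP; rewrite -block_diag_mx_unit -{1}ort -{1}ort' -mul_col_row
  -tr_col_mx -mul_col_mx.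
by rewrite !unitmx_mul fK uG unitmx_tr fK.
Qed.

Definition approximable n := forall G X Y : 'M[R]_n.+1,
  admissible G X Y -> closure (diag_pairs G) (X, Y).

Lemma approximable_decomposable n (G X Y : 'M[R]_n.+1) :
  (forall m, (m < n)%N -> approximable m) ->
  admissible G X Y -> decomposable X -> closure (diag_pairs G) (X, Y).
Proof.
move=> IH [[sG uG sX sY cXY] [rX rY]] dX.
have [n1 [n2 [K1 [K2 [en fK [sX1 sX2] [sY1 sY2] ort]]]]] :=
  decomposable_blocks sG sX cXY dX.
have [fK1 fK2] : row_free K1 /\ row_free K2.
  have [rk _] := mxrank_adds_leqif K1 K2; have := rank_leq_row K1;
    have := rank_leq_row K2.
  move: fK; rewrite /row_free -addsmxE => /eqP fK r2 r1.
  by split; apply/eqP; move: rk r1 r2; rewrite fK; lia.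
have [u1 u2] : K1 *m G *m K1^T \in unitmx /\ K2 *m G *m K2^T \in unitmx.
  by apply: unitmx_gram_blocks; rewrite ?en.
have adm m (K : 'M[R]_(m.+1, n.+1)) :
    row_free K -> stablemx K X -> stablemx K Y -> K *m G *m K^T \in unitmx ->
    admissible (K *m G *m K^T) (conjmx K X) (conjmx K Y).
  move=> fK' sKX sKY u.
  have sa Z : stablemx K Z -> selfadj G Z ->
      selfadj (K *m G *m K^T) (conjmx K Z).
    move=> sZ saZ; rewrite /selfadj.
    have -> : conjmx K Z *m (K *m G *m K^T) = K *m (Z *m G) *m K^T.
      by rewrite !mulmxA; congr (_ *m _ *m _); rewrite /conjmx mulmxKpV.
    by rewrite trmx_mul trmx_mul trmxK saZ mulmxA.
  split; [split|split] => //.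
  - by rewrite !trmx_mul trmxK sG mulmxA.
  - exact: sa.
  - exact: sa.
  - rewrite /GRing.comm -!mulmxE -!conjmxM ?inE//.
    by rewrite mulmxE cXY.
  - exact: root_split_conjmx.
  - exact: root_split_conjmx.
apply: (@diag_pairs_blocks _ _ n1.+1 n2.+1 G X Y K1 K2) => //.
- by rewrite en.
- by apply: IH; [rewrite en; lia|exact: adm].
- by apply: IH; [rewrite en; lia|exact: adm].
Qed.

(** Both perturbations below produce a decomposable member, which brings the pair
    back to smaller dimensions. *)
Lemma approximable_all n : approximable n.
Proof.
elim/ltn_ind: n => n IH G X Y adm.
have decX := approximable_decomposable IH.
have [[sG uG sX sY cXY] [rX rY]] := adm.
have [dX|[a [m Xm]]] := root_split_cases rX; first exact: decX.
have [dY|[b [l Yl]]] := root_split_cases rY.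
  have admYX : admissible G Y X by split; [split => //; exact/commr_sym|].
  exact: diag_pairs_swap (decX _ _ _ admYX dY).
have {sX}sX : selfadj G (X - a%:M).
  by rewrite -scaleN1r; apply: selfadjD => //; apply/selfadjZ/selfadj_scalar.
have {sY}sY : selfadj G (Y - b%:M).
  by rewrite -scaleN1r; apply: selfadjD => //; apply/selfadjZ/selfadj_scalar.
have {cXY}cXY : GRing.comm (X - a%:M) (Y - b%:M).
  have scl (M : 'M[R]_n.+1) r : GRing.comm M r%:M by exact: comm_mx_scalar.
  by apply: commrB => //; apply/commr_sym/commrB => //; exact/commr_sym.
(* From here on [X] and [Y] are replaced by their nilpotent parts. *)
apply: (@diag_pairs_affine _ _ _ _ _ a b 0).
rewrite scale0r addr0.
move: {X Y rX rY adm}(X - a%:M) (Y - b%:M) sX sY cXY Xm Yl =>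
  X Y sX sY cXY Xm Yl.
have [k [t0 [K0 Y0]]] := nilpotent_pencil cXY Xm Yl.
have {}K0 t : (Y + t0 *: X + t *: X) ^+ k.+1 = 0.
  by rewrite -addrA -scalerDl K0.
have scalar0 : 0%:M = 0 :> 'M[R]_n.+1 by rewrite raddf0.
(* [Y] is replaced by a member of the pencil of maximal nilpotency index. *)
apply: (@diag_pairs_affine _ _ _ _ _ 0 0 t0); rewrite scalar0 !subr0.
have {sY}sY : selfadj G (Y + t0 *: X) by apply/selfadjD/selfadjZ.
have {cXY}cXY : GRing.comm X (Y + t0 *: X).
  by apply: commrD => //; rewrite /GRing.comm -scalerAl -scalerAr.
move: {Y Yl}(Y + t0 *: X) sY cXY Y0 K0 => Y sY cXY Y0 K0.
have Yk : Y ^+ k.+1 = 0 by have := K0 0; rewrite scale0r addr0.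
have YkX := pencil_top_power cXY K0.
have [v gN0] : exists v : 'rV_n.+1, (v *m Y ^+ k *m G *m v^T) 0 0 != 0.
  have sYk := selfadjX k sG sY.
  have YkG : Y ^+ k *m G != 0.
    by apply: contra_neq Y0 => YG0; rewrite -[LHS](mulmxK uG) YG0 mul0mx.
  have [v vN0] := symmetric_anisotropic sYk YkG.
  by exists v; rewrite -[v *m _ *m G]mulmxA.
have [kn|nk] := ltnP k n.
  pose f t := (X + t *: cyclic_dir G Y k v, Y).
  have -> : (X, Y) = f 0 by rewrite /f scale0r addr0.
  apply: diag_pairs_limit => [|t t0'].
    apply: cvg_to_pair; last exact: cvg_cst.
    by apply: cvgD; [exact: cvg_cst|apply: cvgZ;
      [exact: cvg_id|exact: cvg_cst]].
  have tN0 : t != 0 by rewrite gt_eqF.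
  apply: decX; last exact: (decomposable_cyclic_dir cXY Yk YkX gN0 tN0 Xm).
  split; split => //.
  - by apply/selfadjD/selfadjZ/selfadj_cyclic_dir.
  - apply/commr_sym/commrD; first exact: commr_sym.
    by rewrite /GRing.comm -scalerAl -scalerAr (cyclic_dir_comm _ _ Yk).
  - exact: (root_split_cyclic_dir G v cXY Yk YkX t Xm).
  - exact: root_split_nilpotent Yk.
have [n0|n_gt0] := posnP n.
  subst n; apply: subset_closure; exists 1%:M; first exact: unitmx1.
  by split; apply/is_diag_mxP => i j; rewrite !ord1.
have [p Xp] := cyclic_commutant nk Yk gN0 cXY.
have k_gt0 := leq_trans n_gt0 nk.
pose c := (v *m Y ^+ (k./2 + k./2).+1 *m G *m v^T) 0 0.
(* The sign that makes the perturbation by [t * sg], [t > 0], satisfy the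
   discriminant condition of [splitting_dir_splits]. *)
pose sg : R := if 0 <= c then 1 else -1.
pose f t := (horner_mx (Y + (t * sg) *: splitting_dir G Y k v) p,
             Y + (t * sg) *: splitting_dir G Y k v).
have -> : (X, Y) = f 0 by rewrite /f mul0r scale0r addr0 -Xp.
have cvg_f : Y + (t * sg) *: splitting_dir G Y k v @[t --> (0 : R)] -->
             Y + (0 * sg) *: splitting_dir G Y k v.
  apply: cvgD; [exact: cvg_cst|apply: cvgZ; last exact: cvg_cst].
  by apply: cvgM; [exact: cvg_id|exact: cvg_cst].
apply: diag_pairs_limit => [|t t0'].
  by apply: cvg_to_pair => //; exact: cvg_horner_mx.
have tN0 : t * sg != 0.
  have sgN0 : sg != 0 by rewrite /sg; case: ifP => _;
    rewrite ?oppr_eq0 oner_eq0.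
  by rewrite mulf_neq0// gt_eqF.
have tc : 0 <= t * sg * c.
  rewrite -mulrA mulr_ge0 ?(ltW t0')// /sg; case: ifPn; rewrite ?mul1r//.
  by rewrite -ltNge mulN1r oppr_ge0 => /ltW.
have [rN dN] := splitting_dir_splits sG sY Yk k_gt0 gN0 tN0 tc.
have sN : selfadj G (Y + (t * sg) *: splitting_dir G Y k v).
  by apply/selfadjD/selfadjZ/selfadj_splitting_dir.
apply: (@diag_pairs_swap); apply: (decX _ _ _ _ dN); split; split => //.
- exact: selfadj_horner.
- exact: comm_mx_horner.
- exact: root_split_horner.
Qed.

End Density.

(** * Necessity *)

Section Necessity.
Variable R : realType.

Lemma cvg_det (T : Type) (F : set_system T) {FF : Filter F} n
  (f : T -> 'M[R]_n) (a : 'M[R]_n) :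
  f x @[x --> F] --> a -> \det (f x) @[x --> F] --> \det a.
Proof.
move=> fa; rewrite /determinant; apply: cvg_big => [|s _].
  exact: add_continuous.
apply: cvgM; first exact: cvg_cst.
by apply: cvg_big => [|i _]; [exact: mul_continuous|exact: cvg_mx_entry].
Qed.

Lemma cvg_invmx (T : Type) (F : set_system T) {FF : Filter F} n
  (f : T -> 'M[R]_n) (a : 'M[R]_n) :
  (forall x, f x \in unitmx) -> a \in unitmx ->
  f x @[x --> F] --> a -> invmx (f x) @[x --> F] --> invmx a.
Proof.
move=> uf ua fa; rewrite /invmx ua; under eq_fun do rewrite uf.
apply: cvgZ.
  by apply: cvgV; [rewrite -unitfE -unitmxE|exact: cvg_det].
apply: cvg_mx => i j; rewrite mxE; under eq_fun do rewrite mxE.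
apply: cvgM; first exact: cvg_cst.
apply: cvg_det; apply: cvg_mx => k l; rewrite !mxE.
under eq_fun do rewrite !mxE.
exact: cvg_mx_entry.
Qed.

Lemma congr_diag_quotient n (A B P : 'M[R]_n) :
    P \in unitmx -> A \in unitmx ->
    is_diag_mx (P^T *m A *m P) -> is_diag_mx (P^T *m B *m P) ->
  exists d, invmx A *m B = P *m diag_mx d *m invmx P.
Proof.
move=> uP uA /diag_mxP[a Ea] /diag_mxP[b Eb].
have a0 j : a 0 j != 0.
  have : P^T *m A *m P \in unitmx by rewrite !unitmx_mul unitmx_tr uP uA.
  by rewrite Ea unitmxE det_diag unitfE => /prodf_neq0; apply.
exists (\row_j (b 0 j / a 0 j)).
have Eab : diag_mx a *m diag_mx (\row_j (b 0 j / a 0 j)) = diag_mx b.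
  by rewrite mulmx_diag; congr diag_mx; apply/rowP => j;
    rewrite !mxE mulrC divfK.
apply: (can_inj (mulKmx uA)); rewrite mulKVmx//.
apply: (can_inj (mulmxK uP)); rewrite -[RHS]mulmxA mulmxKV//.
have uPT : P^T \in unitmx by rewrite unitmx_tr.
apply: (can_inj (mulKmx uPT)).
by rewrite mulmxA Eb -Eab -Ea !mulmxA.
Qed.

(** The determinant is the product of the squared distances from [a + ib] to the
    eigenvalues of [X], which are real. *)
Lemma det_quadratic_lb n (X P : 'M[R]_n) d a b : P \in unitmx ->
  X = P *m diag_mx d *m invmx P ->
  (b ^+ 2) ^+ n <= \det ((X - a%:M) *m (X - a%:M) + (b ^+ 2)%:M).
Proof.
move=> uP EX.
have XP : (X - a%:M) *m P = P *m (diag_mx d - a%:M).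
  by rewrite mulmxBl mulmxBr EX mulmxKV// scalar_mxC.
have QP : ((X - a%:M) *m (X - a%:M) + (b ^+ 2)%:M) *m P =
          P *m diag_mx (\row_j ((d 0 j - a) ^+ 2 + b ^+ 2)).
  rewrite mulmxDl -mulmxA XP mulmxA XP -mulmxA -scalar_mxC -mulmxDr.
  congr (_ *m _).
  have -> : diag_mx d - a%:M = diag_mx (\row_j (d 0 j - a)).
    by apply/matrixP => i j; rewrite !mxE; case: eqP => [->|];
      rewrite ?mulr1n ?mulr0n ?subrr.
  rewrite mulmx_diag; apply/matrixP => i j; rewrite !mxE.
  by case: eqP => [->|_]; rewrite ?mulr1n ?mulr0n ?addr0// expr2.
have -> : \det ((X - a%:M) *m (X - a%:M) + (b ^+ 2)%:M) =
          \prod_j ((d 0 j - a) ^+ 2 + b ^+ 2).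
  have dP : \det P != 0 by rewrite -unitfE -unitmxE.
  apply: (mulIf dP); rewrite -det_mulmx QP det_mulmx mulrC det_diag.
  by congr (_ * _); apply: eq_bigr => j _; rewrite mxE.
have <- : \prod_(j < n) (b ^+ 2) = (b ^+ 2) ^+ n.
  by rewrite prodr_const card_ord.
by apply: ler_prod => j _; rewrite sqr_ge0/= lerDr sqr_ge0.
Qed.

(** An eigenvector of [X] for [a + ib] is killed by [(X - a)^2 + b^2]. *)
Lemma real_eigenvalues_of_det n (X : 'M[R]_n) :
  (forall a b,
    (b ^+ 2) ^+ n <= \det ((X - a%:M) *m (X - a%:M) + (b ^+ 2)%:M)) ->
  real_eigenvalues X.
Proof.
move=> lb [a b] /eigenvalueP[v vX vN0] /=; apply/eqP/negPn/negP => bN0.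
have := lb a b; rewrite leNgt => /negP; apply.
have -> : \det ((X - a%:M) *m (X - a%:M) + (b ^+ 2)%:M) = 0.
  apply/eqP; rewrite -(fmorph_eq0 (real_complex R)) -det_map_mx; apply/det0P;
    exists v => //.
  rewrite map_mxD map_mxM map_mxB !map_scalar_mx/= mulmxDr mulmxA.
  have vXa : v *m (map_mx (real_complex R) X - (real_complex R a)%:M) =
    (0 +i* b)%C *: v.
    rewrite mulmxBr vX mul_mx_scalar -scalerBl; congr (_ *: _).
    by apply/eqP; rewrite eq_complex /= subrr oppr0 addr0 !eqxx.
  rewrite vXa -scalemxAl vXa mul_mx_scalar scalerA -scalerDl.
  have -> : (0 +i* b)%C * (0 +i* b)%C + real_complex R (b ^+ 2) = 0.
    by apply/eqP; rewrite eq_complex /=; apply/andP; split; apply/eqP; ring.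
  by rewrite scale0r.
by rewrite exprn_gt0// exprn_even_gt0.
Qed.

Lemma ASDC_necessary n (A B C : 'M[R]_n) : A \in unitmx -> ASDC [set A; B; C] ->
  [/\ comm_mx (invmx A *m B) (invmx A *m C),
      real_eigenvalues (invmx A *m B) & real_eigenvalues (invmx A *m C)].
Proof.
move=> uA [u [uF uS]].
have [[_ cA] [_ cB] [_ cC]] :
  [/\ (forall i, u A i \is symmetricmx) /\ (u A i @[i --> \oo] --> A),
  (forall i, u B i \is symmetricmx) /\ (u B i @[i --> \oo] --> B) &
  (forall i, u C i \is symmetricmx) /\ (u C i @[i --> \oo] --> C)].
  by split; apply: uF; rewrite /=; tauto.
(* Invertibility holds only from some rank [N] on; the sequences are shifted by
   [N]. *)
have [N uN] : exists N, forall i, u A (i + N)%N \in unitmx.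
  have dA : \det A != 0 by rewrite -unitfE -unitmxE.
  have [N _ NP] := cvgr_neq0 _ (cvg_det cA) dA.
  by exists N => i; rewrite unitmxE unitfE; apply: NP; rewrite /= leq_addl.
have shift M : u M i @[i --> \oo] --> M -> u M (i + N)%N @[i --> \oo] --> M.
  by move=> cM; have := cM; rewrite -(cvg_shiftn N).
have cAV : invmx (u A (i + N)%N) @[i --> \oo] --> invmx A.
  exact: cvg_invmx uN uA (shift _ cA).
pose X M i := invmx (u A (i + N)%N) *m u M (i + N)%N.
have cX M : u M i @[i --> \oo] --> M -> X M i @[i --> \oo] --> invmx A *m M.
  by move=> cM; exact: cvg_mulmx cAV (shift _ cM).
have XP i : exists2 P, P \in unitmx & forall M, [set A; B; C] M ->
    exists d, X M i = P *m diag_mx d *m invmx P.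
  have [P uP dP] := uS (i + N)%N; exists P => // M FM.
  by apply: congr_diag_quotient => //; apply: dP;
    [exists A => //; left; left|exists M].
have lb M : [set A; B; C] M -> u M i @[i --> \oo] --> M ->
    real_eigenvalues (invmx A *m M).
  move=> FM cM; apply: real_eigenvalues_of_det => a b.
  pose q (Z : 'M[R]_n) := \det ((Z - a%:M) *m (Z - a%:M) + (b ^+ 2)%:M).
  have cq : q (X M i) @[i --> \oo] --> q (invmx A *m M).
    apply: cvg_det; apply: cvgD; last exact: cvg_cst.
    by apply: cvg_mulmx; (apply: cvgB; [exact: cX|exact: cvg_cst]).
  rewrite -[X in _ <= X](cvg_lim _ cq)//; apply: limr_ge.
    exact: cvgP cq.
  apply: nearW => i; have [P uP dP] := XP i; have [d Xd] := dP _ FM.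
  exact: det_quadratic_lb uP Xd.
split; [|by apply: lb => //; left; right|by apply: lb => //; right].
have cXM M M' : u M i @[i --> \oo] --> M -> u M' i @[i --> \oo] --> M' ->
    X M i *m X M' i @[i --> \oo] --> invmx A *m M *m (invmx A *m M').
  by move=> cM cM'; exact: cvg_mulmx (cX _ cM) (cX _ cM').
have [cBC cCB] := (cXM _ _ cB cC, cXM _ _ cC cB).
apply: (@norm_cvg_unique _ _ (X B i *m X C i @[i --> \oo])) => //=.
have -> : (fun i => X B i *m X C i) = (fun i => X C i *m X B i) => //.
apply/funext => i; have [P uP dP] := XP i.
have [b ->] : exists d, X B i = P *m diag_mx d *m invmx P.
  by apply: dP; left; right.
have [c ->] : exists d, X C i = P *m diag_mx d *m invmx P by apply: dP; right.
by rewrite !mulmxA !mulmxKV// -![P *m _ *m _]mulmxA diag_mxC.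
Qed.
End Necessity.

(** * Sufficiency *)

Section Sufficiency.
Variable R : realType.

Lemma symmetricmxE n (M : 'M[R]_n) : (M \is symmetricmx) = (M == M^T).
Proof. by rewrite is_hermitianmxE expr0 scale1r map_mx_id. Qed.

(** The characteristic polynomial splits over the complex numbers with real roots,
    hence over the reals. *)
Lemma root_split_of_real_eigenvalues n (X : 'M[R]_n.+1) :
  real_eigenvalues X -> root_split X.
Proof.
move=> rX; have [r Er] := closed_field_poly_normal
  (map_poly (real_complex R) (char_poly X)).
rewrite lead_coef_map (monicP (char_poly_monic X)) rmorph1 scale1r in Er.
have rr z : z \in r -> z = real_complex R (complex.Re z).
  move=> zr; have : eigenvalue (map_mx (real_complex R) X) z.
    by rewrite eigenvalue_root_char -map_char_poly Er root_prod_XsubC.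
  by move=> /rX; case: (z) => x y /= ->.
exists [seq complex.Re z | z <- r].
rewrite -[RHS](Cayley_Hamilton X); congr (horner_mx X _).
apply: (map_poly_inj (real_complex R));
  rewrite Er rmorph_prod big_map big_seq [RHS]big_seq.
apply: eq_bigr => z zr.
by rewrite rmorphB/= map_polyX map_polyC /= -rr.
Qed.

Lemma symmetric_of_congr_diag n (P M : 'M[R]_n) :
  P \in unitmx -> is_diag_mx (P^T *m M *m P) -> M = M^T.
Proof.
move=> uP /diag_mxP[d Ed]; have uPT : P^T \in unitmx by rewrite unitmx_tr.
apply: (can_inj (mulKmx uPT)); apply: (can_inj (mulmxK uP)).
have -> : P^T *m M^T *m P = (P^T *m M *m P)^T by rewrite !trmx_mul trmxK mulmxA.
by rewrite Ed tr_diag_mx.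
Qed.

Lemma ASDC_sufficient n (A B C : 'M[R]_n) :
    A \is symmetricmx -> B \is symmetricmx -> C \is symmetricmx ->
    A \in unitmx ->
    comm_mx (invmx A *m B) (invmx A *m C) ->
    real_eigenvalues (invmx A *m B) -> real_eigenvalues (invmx A *m C) ->
  ASDC [set A; B; C].
Proof.
case: n A B C => [|n] A B C.
  move=> sA sB sC _ _ _ _; exists (fun M _ => M); split.
    by move=> M FM; split; [case: FM => [[|]|] ->|exact: cvg_cst].
  move=> i; exists 1%:M; first exact: unitmx1.
  by move=> M _; apply/is_diag_mxP => -[].
rewrite !symmetricmxE => /eqP sA /eqP sB /eqP sC uA cBC rB rC.
pose G := invmx A; pose X := G *m B; pose Y := G *m C.
have sG : G^T = G by rewrite /G trmx_inv -sA.
have sGM M : M = M^T -> selfadj G (G *m M).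
  by move=> sM; rewrite /selfadj !trmx_mul sG -sM mulmxA.
have adm : admissible G X Y.
  split; last first.
    by split; [exact: root_split_of_real_eigenvalues rB|
               exact: root_split_of_real_eigenvalues rC].
  by split; [exact: sG|rewrite unitmx_inv|exact: sGM|exact: sGM|exact: cBC].
have cl := approximable_all adm.
have /choice[Z Zd] : forall i : nat, exists Z : 'M[R]_n.+1 * 'M[R]_n.+1,
    diag_pairs G Z /\ ball (X, Y) i.+1%:R^-1 Z.
  move=> i; have [|Z [dZ bZ]] := cl (ball (X, Y) i.+1%:R^-1).
    by apply: nbhsx_ballx; rewrite invr_gt0.
  by exists Z.
have cZ : Z i @[i --> \oo] --> (X, Y).
  apply/cvg_ballP => e e0; near=> i; apply: le_ball (proj2 (Zd i)).
  by apply/ltW; near: i; exact: near_infty_natSinv_lt (PosNum e0).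
have cZ1 : (Z i).1 @[i --> \oo] --> X by exact: (cvg_comp _ _ cZ cvg_fst).
have cZ2 : (Z i).2 @[i --> \oo] --> Y by exact: (cvg_comp _ _ cZ cvg_snd).
(* The tests absorb coincidences among [A], [B] and [C]. *)
pose u M i :=
  if M == A then A else if M == B then A *m (Z i).1 else A *m (Z i).2.
have uP i : exists2 P, P \in unitmx & forall M, is_diag_mx (P^T *m u M i *m P).
  have [[Q uQ [dG d1 d2]] _] := Zd i.
  exists (G *m Q^T); first by rewrite unitmx_mul unitmx_inv uA unitmx_tr.
  move=> M; rewrite trmx_mul trmxK sG /u.
  have GA W : Q *m G *m (A *m W) *m (G *m Q^T) = Q *m W *m G *m Q^T.
    by rewrite !mulmxA; congr (_ *m _ *m _);
      rewrite /G -[Q *m _ *m _]mulmxA mulVmx// mulmx1.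
  case: ifP => _; first by have := GA 1%:M; rewrite !mulmx1 => ->.
  by case: ifP => _; rewrite GA.
exists u; split; last first.
  by move=> i; have [P uP' dP] := uP i; exists P => // _ [M _ <-].
move=> M FM; split.
  move=> i; have [P uP' dP] := uP i.
  by rewrite symmetricmxE; apply/eqP/(symmetric_of_congr_diag uP').
rewrite /u; have [->|MA] := eqVneq M A; first exact: cvg_cst.
have cAZ (z : nat -> 'M[R]_n.+1) W : z i @[i --> \oo] --> G *m W ->
    A *m z i @[i --> \oo] --> W.
  move=> zW; rewrite -[W](mulKVmx uA); apply: cvg_mulmx => //; exact: cvg_cst.
have [->|MB] := eqVneq M B; first exact: cAZ.
have -> : M = C by case: FM => [[|]|] // E; move: MA MB; rewrite E eqxx.
exact: cAZ.
Unshelve. all: by end_near. Qed.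

End Sufficiency.

Theorem theorem3 (R : realType) (n : nat) (A B C : 'M[R]_n)
    (symA : A \is symmetricmx) (symB : B \is symmetricmx)
    (symC : C \is symmetricmx) (unitA : A \in unitmx) :
  ASDC [set A; B; C] <->
  [/\ comm_mx (invmx A *m B) (invmx A *m C),
      real_eigenvalues (invmx A *m B) &
      real_eigenvalues (invmx A *m C)].
Proof.
split; first exact: ASDC_necessary.
by case; exact: ASDC_sufficient.
Qed.
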